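(* Let $q$ be a prime power, let $p\in\mathbb{P}^2(\overline{\mathbb{F}}_q)$ be a $q^n$-point, let $0<r<n$, and let the line $\ell=\langle p,f^r(p)\rangle$ be a $q^k$-line. Then $k\mid n$, and if $k\neq n$ then $k\mid r$.
   Context: $f=\mathrm{Frob}_q$ acts on $\mathbb{P}^2(\overline{\mathbb{F}}_q)$ by raising coordinates to the $q$th power, and correspondingly on lines. A point (respectively line) whose $f$-orbit has exactly $n$ elements is called a $q^n$-point (respectively $q^n$-line). For distinct points $p_1,p_2$, $\langle p_1,p_2\rangle$ is the unique line containing both. *)

(* Defs.v *)
From HB Require Import structures.
From mathcomp Require Import all_boot all_order all_algebra all_fingroup.
From mathcomp Require Import all_solvable all_field.

Set Implicit Arguments.
Unset Strict Implicit.
Unset Printing Implicit Defensive.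

Import GRing.Theory.
Local Open Scope ring_scope.

(* K is an algebraic closure of F via iota; algebraic closedness is part of   *)
(* the structure closedFieldType.                                             *)
Definition is_algebraic_closure (F : fieldType) (K : closedFieldType)
    (iota : {rmorphism F -> K}) : Prop :=
  forall x : K, algebraicOver iota x.

(* With F the field with q elements, Frob iota is x |-> x ^ q on K.           *)
(* The argument iota only serves to make this map a ring morphism.            *)
Definition Frob (F : finFieldType) (K : fieldType)
    (iota : {rmorphism F -> K}) (x : K) : K := x ^+ #|F|.

Section FrobMorphism.
Variables (F : finFieldType) (K : fieldType) (iota : {rmorphism F -> K}).

Lemma pchar_card_nat : [pchar K].-nat #|F|.
Proof.
have [p p_pr pF] := finPcharP F.
have: (p.-nat #|F|)%N by have := pprimeChar_pgroup pF; rewrite /pgroup cardsT.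
apply: sub_in_pnat => r _; rewrite inE => /eqP->.
exact: (rmorph_pchar iota pF).
Qed.

Fact Frob_is_zmod_morphism : zmod_morphism (Frob iota).
Proof.
move=> x y; rewrite /Frob exprDn_pchar ?pchar_card_nat //; congr (_ + _).
rewrite exprNn_pchar ?pchar_card_nat //.
Qed.

Fact Frob_is_monoid_morphism : monoid_morphism (Frob iota).
Proof. by split=> [|x y]; rewrite /Frob ?expr1n ?exprMn. Qed.

HB.instance Definition _ := GRing.isZmodMorphism.Build K K (Frob iota)
  Frob_is_zmod_morphism.
HB.instance Definition _ := GRing.isMonoidMorphism.Build K K (Frob iota)
  Frob_is_monoid_morphism.

End FrobMorphism.

(* Points and lines of P^2(K) are the linear subspaces of K^3 of dimension 1  *)
(* and 2; the point with homogeneous coordinates v is <[v]>%VS.               *)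
Definition proj_subspace (K : fieldType) (d : nat) : Type :=
  {U : {vspace 'rV[K]_3} | \dim U == d}.
HB.instance Definition _ (K : fieldType) d := SubType.on (proj_subspace K d).
HB.instance Definition _ (K : fieldType) d := Equality.on (proj_subspace K d).

Definition point (K : fieldType) : Type := proj_subspace K 1.
HB.instance Definition _ (K : fieldType) := SubType.on (point K).
HB.instance Definition _ (K : fieldType) := Equality.on (point K).

Definition line (K : fieldType) : Type := proj_subspace K 2.
HB.instance Definition _ (K : fieldType) := SubType.on (line K).
HB.instance Definition _ (K : fieldType) := Equality.on (line K).

Definition on_line (K : fieldType) (p : point K) (l : line K) : bool :=
  (val p <= val l)%VS.

Section LineThrough.
Variable K : fieldType.

Fact line_inf_proof :
  \dim (<[delta_mx 0%R 0%R : 'rV[K]_3]> +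
        <[delta_mx 0%R 1%R : 'rV[K]_3]>)%VS == 2.
Proof.
rewrite dimv_disjoint_sum; first last.
  apply/eqP; rewrite -subv0; apply/subvP => v.
  rewrite memv_cap memv0 => /andP[/vlineP[a ->] /vlineP[b]].
  move/matrixP/(_ 0 0); rewrite !mxE /= mulr1 mulr0 => ->.
  by rewrite scale0r.
have nz (j : 'I_3) : delta_mx 0 j != 0 :> 'rV[K]_3.
  by apply/eqP => /matrixP/(_ 0 j)/eqP; rewrite !mxE !eqxx oner_eq0.
by rewrite !dim_vline !nz.
Qed.

Definition line_inf : line K :=
  exist (fun U : {vspace 'rV[K]_3} => \dim U == 2) _ line_inf_proof.

(* The line through p1 and p2 when p1 != p2 (see line_throughP); the default  *)
(* value line_inf is only used when p1 = p2.                                  *)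
Definition line_through (p1 p2 : point K) : line K :=
  insubd line_inf (val p1 + val p2)%VS.

Lemma val_line_through (p1 p2 : point K) :
  p1 != p2 -> val (line_through p1 p2) = (val p1 + val p2)%VS.
Proof.
case: p1 p2 => [U dU] [V dV]; rewrite -val_eqE /= => nUV.
rewrite val_insubd ifT //= dimv_disjoint_sum ?(eqP dU) ?(eqP dV) //.
apply/eqP; rewrite -dimv_eq0.
have := dimv_leqif_eq (capvSl U V); rewrite (eqP dU) => -[le1 eq1].
move: le1 eq1; case: (\dim _) => [|[|n]] //= _ /esym/eqP UV.
have sUV : (U <= V)%VS by rewrite -UV capvSr.
by case/eqP: nUV; apply/eqP; rewrite eqEdim sUV (eqP dU) (eqP dV).
Qed.

Lemma line_throughP (p1 p2 : point K) (l : line K) :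
  p1 != p2 -> (on_line p1 l /\ on_line p2 l) <-> l = line_through p1 p2.
Proof.
move=> np; rewrite /on_line; split=> [[s1 s2] | ->].
  apply/esym/val_inj/eqP; rewrite eqEdim (eqP (valP l)).
  apply/andP; split; last by rewrite (eqP (valP (line_through p1 p2))).
  by rewrite val_line_through // subv_add s1.
by rewrite val_line_through // addvSl addvSr.
Qed.

End LineThrough.

Section FrobAction.
Variables (F : finFieldType) (K : closedFieldType) (iota : {rmorphism F -> K}).

Definition Frob_vec (v : 'rV[K]_3) : 'rV[K]_3 := map_mx (Frob iota) v.

(* The image of U under Frob_vec, which is again a subspace (see              *)
(* Frob_spaceP), presented as the span of the image of a basis.               *)
Definition Frob_space (U : {vspace 'rV[K]_3}) : {vspace 'rV[K]_3} :=
  <<[seq Frob_vec v | v <- vbasis U]>>%VS.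

Fact Frob_vecD u v : Frob_vec (u + v) = Frob_vec u + Frob_vec v.
Proof. exact: map_mxD. Qed.

Fact Frob_vecZ a v : Frob_vec (a *: v) = Frob iota a *: Frob_vec v.
Proof. exact: map_mxZ. Qed.

Fact Frob_vec_inj : injective Frob_vec.
Proof. exact: map_mx_inj. Qed.

Fact Frob_vec_sum n (c : 'I_n -> K) (X : seq 'rV[K]_3) : size X = n ->
  Frob_vec (\sum_(i < n) c i *: X`_i) =
  \sum_(i < n) Frob iota (c i) *: [seq Frob_vec v | v <- X]`_i.
Proof.
move=> sX; rewrite (big_morph _ Frob_vecD (map_mx0 _ _ _)).
by apply: eq_bigr => i _; rewrite Frob_vecZ (nth_map 0) ?sX.
Qed.

Fact Frob_surj (y : K) : exists x, Frob iota x = y.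
Proof.
have F0 : (0 < #|F|)%N by apply/card_gt0P; exists 0.
have [x xE] := solve_monicpoly (fun i => if i == 0%N then y else 0) F0.
exists x; rewrite /Frob xE (bigD1 (Ordinal F0)) //= mulr1 big1 ?addr0 // => i.
by rewrite -val_eqE /= => /negPf->; rewrite mul0r.
Qed.

Lemma Frob_spaceP (U : {vspace 'rV[K]_3}) (w : 'rV[K]_3) :
  reflect (exists2 v, v \in U & w = Frob_vec v) (w \in Frob_space U).
Proof.
have sB : size (vbasis U) = \dim U by rewrite size_tuple.
apply: (iffP idP) => [wU | [v vU ->]].
  pose c i := coord (map_tuple Frob_vec (vbasis U)) i w.
  rewrite (coord_span (X := map_tuple Frob_vec (vbasis U)) wU).
  have [d dE] : exists d : 'I_(\dim U) -> K, forall i, Frob iota (d i) = c i.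
    exact: (fin_all_exists (fun i => Frob_surj (c i))).
  exists (\sum_i d i *: (vbasis U)`_i); last first.
    by rewrite Frob_vec_sum //; apply: eq_bigr => i _; rewrite dE.
  by apply: memv_suml => i _; rewrite memvZ // vbasis_mem // mem_nth ?sB.
rewrite (coord_vbasis vU) Frob_vec_sum //.
apply: memv_suml => i _; rewrite memvZ // memv_span // mem_nth //.
by rewrite size_map sB.
Qed.

Lemma dim_Frob_space U : \dim (Frob_space U) = \dim U.
Proof.
have sB : size (vbasis U) = \dim U by rewrite size_tuple.
suff /eqP-> : free [seq Frob_vec v | v <- vbasis U] by rewrite size_map.
apply/(freeP (X := map_tuple Frob_vec (vbasis U))) => k k0.
have [d dE] : exists d : 'I_(\dim U) -> K, forall i, Frob iota (d i) = k i.
  exact: (fin_all_exists (fun i => Frob_surj (k i))).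
have d0 : \sum_i d i *: (vbasis U)`_i = 0.
  apply: Frob_vec_inj; rewrite Frob_vec_sum // [RHS]map_mx0 -[RHS]k0.
  by apply: eq_bigr => i _; rewrite dE.
move=> i; rewrite -dE; have /freeP-> := basis_free (vbasisP U) => //.
exact: rmorph0.
Qed.

Fact Frob_act_proof d (U : proj_subspace K d) :
  \dim (Frob_space (val U)) == d.
Proof. by rewrite dim_Frob_space (valP U). Qed.

Definition Frob_act d (U : proj_subspace K d) : proj_subspace K d :=
  exist (fun V : {vspace 'rV[K]_3} => \dim V == d) _ (Frob_act_proof U).

Definition Frob_point : point K -> point K := @Frob_act 1.
Definition Frob_line : line K -> line K := @Frob_act 2.

Lemma Frob_pointE (p : point K) v :
  val p = <[v]>%VS -> val (Frob_point p) = <[Frob_vec v]>%VS.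
Proof.
move=> pv; apply/vspaceP => w; apply/Frob_spaceP/vlineP => [[u] | [a ->]].
  by rewrite pv => /vlineP[b ->] ->; exists (Frob iota b); rewrite Frob_vecZ.
have [b <-] := Frob_surj a; exists (b *: v); last by rewrite Frob_vecZ.
by rewrite pv memvZ // memv_line.
Qed.

Lemma Frob_lineP (p : point K) (l : line K) :
  on_line p (Frob_line l) <->
  exists2 p0, on_line p0 l & p = Frob_point p0.
Proof.
rewrite /on_line; split=> [pl | [p0 p0l ->]]; last first.
  apply/subvP => w /Frob_spaceP[v vp ->]; apply/Frob_spaceP.
  by exists v => //; apply: subvP p0l _ vp.
pose w := vpick (val p).
have nw : w != 0 by rewrite vpick0 -dimv_eq0 (eqP (valP p)).
have pw : val p = <[w]>%VS.
  by apply/esym/eqP; rewrite eqEdim -memvE memv_pick dim_vline nw (eqP (valP p)).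
have /Frob_spaceP[v vl wv] : w \in val (Frob_line l).
  by apply: (subvP pl); apply: memv_pick.
have dv : \dim <[v]> == 1%N.
  rewrite dim_vline; case: (v =P 0) nw => // v0.
  by rewrite wv v0 /Frob_vec map_mx0 eqxx.
exists (exist (fun V : {vspace 'rV[K]_3} => \dim V == 1%N) <[v]>%VS dv).
  by rewrite /= -memvE.
by apply: val_inj; rewrite pw wv; apply/esym/Frob_pointE.
Qed.

End FrobAction.

(* The forward orbit {x, f x, f (f x), ...} has exactly n elements. *)
Definition orbit_size (T : eqType) (f : T -> T) (x : T) (n : nat) : Prop :=
  exists s : seq T,
    [/\ uniq s, size s = n & forall y, y \in s <-> exists i, y = iter i f x].

(* q^n-points and q^n-lines, where q = #|F| *)
Definition q_point (F : finFieldType) (K : closedFieldType)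
    (iota : {rmorphism F -> K}) (n : nat) (p : point K) : Prop :=
  orbit_size (Frob_point iota) p n.

Definition q_line (F : finFieldType) (K : closedFieldType)
    (iota : {rmorphism F -> K}) (n : nat) (l : line K) : Prop :=
  orbit_size (Frob_line iota) l n.

(* Main.v *)
Require Import Defs.
From mathcomp Require Import all_boot all_order all_algebra all_field.

(** Write [l] for the line through [p] and [f^r p]. As [f^n] fixes [p] and
    [f^r p], it fixes [l], so [k %| n]. If [k] does not divide [r], then [l] and
    [f^r l] are distinct lines, both fixed by [f^k], and they meet in [f^r p];
    so [f^k] fixes this point, hence [n %| k]. *)

Section InjectiveOrbit.
Variables (T : eqType) (f : T -> T) (x : T).
Hypothesis f_inj : injective f.

Lemma iter_inj i : injective (iter i f).
Proof. by elim: i => [|i IHi] y z //= /f_inj/IHi. Qed.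

Lemma iter_eq_sub i j : i <= j -> iter i f x = iter j f x ->
  iter (j - i) f x = x.
Proof. by move=> le_ij; rewrite -{1}(subnKC le_ij) iterD => /iter_inj. Qed.

Lemma iter_mul_fix d m : iter d f x = x -> iter (m * d) f x = x.
Proof. by move=> fix_x; elim: m => //= m IHm; rewrite mulSn iterD IHm. Qed.

(** Pigeonhole: the iterates of index 0 to [n] all lie in a set of [n] elements, so two of them
    agree, and injectivity cancels the smaller index. *)
Lemma orbit_size_periodic n : orbit_size f x n ->
  exists2 d, 0 < d & iter d f x = x.
Proof.
case=> s [_ size_s mem_s].
have: ~~ uniq [seq iter i f x | i <- iota 0 n.+1].
  apply: contraL (ltnSn n) => uniq_t; rewrite -leqNgt -{2}size_s.
  rewrite -[n.+1](size_iota 0) -(size_map (fun i => iter i f x)).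
  by apply: uniq_leq_size => // _ /mapP[i _ ->]; apply/mem_s; exists i.
case/(uniqPn x) => i [j [lt_ij]]; rewrite size_map size_iota => lt_jn.
have lt_in := ltn_trans lt_ij lt_jn.
rewrite !(nth_map 0) ?size_iota // !nth_iota // !add0n => eq_ij.
by exists (j - i); [rewrite subn_gt0 | apply: iter_eq_sub => //; apply: ltnW].
Qed.

(** Let [d] be the least positive period. The periods are exactly the multiples of [d], and the
    first [d] iterates list the orbit without repetition, so [n = d]. *)
Lemma orbit_size_iter n i : orbit_size f x n -> (iter i f x = x <-> n %| i).
Proof.
move=> orb_n; have [d0 d0_gt0 d0_fix] := orbit_size_periodic _ orb_n.
have: exists d, (0 < d) && (iter d f x == x) by exists d0; rewrite d0_gt0 d0_fix /=.
case/ex_minnP=> d /andP[d_gt0 /eqP d_fix] d_min.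
have iter_mod j : iter j f x = iter (j %% d) f x.
  by rewrite {1}(divn_eq j d) addnC iterD iter_mul_fix.
have fixP j : iter j f x = x <-> d %| j.
  split=> [j_fix | /dvdnP[m ->]]; last exact: iter_mul_fix.
  (* Otherwise the remainder [j %% d] would be a positive period below [d]. *)
  apply/negPn/negP=> ndv; have := ltn_pmod j d_gt0; rewrite ltnNge d_min //.
  by rewrite lt0n ndv -iter_mod j_fix /=.
suff -> : n = d by [].
case: orb_n => s [uniq_s <- mem_s].
have uniq_t : uniq [seq iter j f x | j <- iota 0 d].
  rewrite map_inj_in_uniq ?iota_uniq // => j1 j2.
  rewrite !mem_iota /= !add0n.
  wlog le_j : j1 j2 / j1 <= j2 => [IH | _ lt2 /(iter_eq_sub _ _ le_j)/fixP dv].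
    by case/orP: (leq_total j1 j2) => le_j lt1 lt2 E; [|symmetry]; apply: IH.
  (* The difference [j2 - j1] is a multiple of [d] smaller than [d], hence zero. *)
  apply/eqP; rewrite eqn_leq le_j -subn_eq0 /= eqn0Ngt.
  by apply: contraL dv => /gtnNdvd-> //; apply: leq_ltn_trans (leq_subr _ _) lt2.
rewrite -[d in RHS](size_iota 0) -(size_map (fun j => iter j f x)).
apply/perm_size/uniq_perm => // y; apply/idP/mapP => [/mem_s[j ->] | [j _ ->]].
  by exists (j %% d); [rewrite mem_iota /= ltn_pmod | apply: iter_mod].
by apply/mem_s; exists j.
Qed.

End InjectiveOrbit.

Lemma two_points_line_uniq (K : fieldType) (p1 p2 : point K) (l1 l2 : line K) :
  p1 != p2 -> on_line p1 l1 -> on_line p2 l1 -> on_line p1 l2 ->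
  on_line p2 l2 -> l1 = l2.
Proof.
move=> np a b c d.
rewrite ((line_throughP l1 np).1 (conj a b)).
by rewrite ((line_throughP l2 np).1 (conj c d)).
Qed.

Section FrobIncidence.
Variables (F : finFieldType) (K : closedFieldType) (iota : {rmorphism F -> K}).

(** Since [Frob_vec] is injective on vectors, [v] lies in [U] exactly when its image lies in
    [Frob_space U], so the image determines [U]. *)
Lemma Frob_act_inj d : injective (@Frob_act F K iota d).
Proof.
move=> U V /(congr1 val) /= eqUV; apply/val_inj/vspaceP => v.
have /vspaceP/(_ (Frob_vec iota v)) := eqUV => eq_v.
have mem_Frob W : (Frob_vec iota v \in Frob_space iota W) = (v \in W).
  apply/Frob_spaceP/idP => [[u uW /Frob_vec_inj->] // | vW].
  by exists v.
by rewrite !mem_Frob in eq_v.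
Qed.

Lemma iter_Frob_on_line i (p : point K) (l : line K) : on_line p l ->
  on_line (iter i (Frob_point iota) p) (iter i (Frob_line iota) l).
Proof.
move=> pl; elim: i => //= i IHi; apply/Frob_lineP.
by exists (iter i (Frob_point iota) p).
Qed.

End FrobIncidence.

Theorem lemma4p3 (F : finFieldType) (K : closedFieldType)
    (iota : {rmorphism F -> K}) (hK : is_algebraic_closure iota)
    (n r k : nat) (p : point K) (hp : q_point iota n p)
    (hr0 : 0 < r) (hrn : r < n)
    (hl : q_line iota k (line_through p (iter r (Frob_point iota) p))) :
  k %| n /\ (k <> n -> k %| r).
Proof.
set f := Frob_point iota; set g := Frob_line iota.
set fp := iter r f p in hl *; set l := line_through p fp in hl *.
have f_inj : injective f by apply: Frob_act_inj.
have g_inj : injective g by apply: Frob_act_inj.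
have pP i : iter i f p = p <-> n %| i by apply: orbit_size_iter hp.
have lP i : iter i g l = l <-> k %| i by apply: orbit_size_iter hl.
(* This rules out the default value of [line_through]; it holds because [n] cannot divide [r] when
   [0 < r < n]. *)
have neq : p != fp.
  by apply/eqP=> /esym/pP; rewrite gtnNdvd.
have [pl fpl] : on_line p l /\ on_line fp l by apply/line_throughP.
have kn : k %| n.
  have fix_p : iter n f p = p by apply/pP.
  have fix_fp : iter n f fp = fp by rewrite /fp -iterD addnC iterD fix_p.
  apply/lP; apply: (two_points_line_uniq _ _ _ _ _ neq) => //.
    by rewrite -{1}fix_p iter_Frob_on_line.
  by rewrite -{1}fix_fp iter_Frob_on_line.
split=> // nkn.
have fix_l : iter k g l = l by apply/lP.
have fix_gl : iter k g (iter r g l) = iter r g l.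
  by rewrite -iterD addnC iterD fix_l.
have fpgl : on_line fp (iter r g l) by apply: iter_Frob_on_line.
(* If [f^k] fixes [fp], cancelling [f^r] shows that it fixes [p], so [n %| k] and thus [k = n],
   which is excluded. *)
have [fix_fp | neq_fp] := eqVneq (iter k f fp) fp.
  case: nkn; apply/eqP; rewrite eqn_dvd kn /=; apply/pP.
  by move: fix_fp; rewrite /fp -iterD addnC iterD => /(iter_inj _ _ f_inj).
(* Otherwise [fp] and its image under [f^k] are distinct points, both on [l] and on [g^r l] because
   [g^k] fixes these lines; so the lines coincide. *)
apply/lP; apply/esym.
apply: (two_points_line_uniq _ (iter k f fp) fp) => //.
  by rewrite -{1}fix_l iter_Frob_on_line.
by rewrite -{1}fix_gl iter_Frob_on_line.
Qed.
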